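(* Let $k\ge 2$ and $1\le d<k-1$ be positive integers. If $G$ is a $k$-uniform hypergraph on $n\ge k$ vertices (it is not assumed that $k\mid n$) that satisfies $$\delta_d(G)>\frac{k-1}{k}\,\frac{n}{n-1}\binom{n-d}{k-d},$$ then $$h(G)\ge\frac{n}{k}\ln\left(\frac{k}{n}\,\frac{\binom{n}{d}}{\binom{k}{d}}\,\delta_d(G)\right).$$
   Context: A $k$-uniform hypergraph $G=(V,E)$ consists of a finite vertex set $V$ and a set $E$ of $k$-element subsets of $V$ (edges). For $0\le d\le k-1$ and a $d$-subset $A$ of $V$, the $d$-degree $\deg_d A$ is the number of edges containing $A$ as a subset, and $\delta_d(G)$ is the minimum of $\deg_d A$ over all $d$-subsets $A$ of $V$. A fractional perfect matching of $G$ is a weight assignment $\mathbf{x}\in[0,1]^E$ such that $\sum_{e\ni v}\mathbf{x}_e=1$ for every vertex $v\in V$. Its entropy is $h(\mathbf{x}):=-\sum_{e\in E}\mathbf{x}_e\ln\mathbf{x}_e$, with the convention $0\ln 0=0$. The entropy of $G$ is $h(G):=\sup_{\mathbf{x}}h(\mathbf{x})$, where $\mathbf{x}$ ranges over all fractional perfect matchings of $G$ (with value $-\infty$ if there are none). *)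

(* Defs.v *)
From mathcomp Require Import all_boot all_order all_algebra.
From mathcomp Require Import all_classical all_reals all_analysis.

Set Implicit Arguments.
Unset Strict Implicit.
Unset Printing Implicit Defensive.

Import Order.TTheory GRing.Theory Num.Theory.
Local Open Scope ring_scope.

(* A hypergraph on the finite vertex type V is given by its edge set E. *)
Definition uniform_hypergraph (k : nat) (V : finType) (E : {set {set V}}) : Prop :=
  forall e : {set V}, e \in E -> #|e| = k.

Definition degree (V : finType) (E : {set {set V}}) (A : {set V}) : nat :=
  #|[set e in E | A \subset e]|.

(* Since degree E A <= #|E| for every A, the initial value #|E| does not affect
   the minimum as soon as V has a d-subset, i.e. d <= #|V|. *)
Definition min_degree (V : finType) (E : {set {set V}}) (d : nat) : nat :=
  \big[minn/#|E|]_(A : {set V} | #|A| == d) degree E A.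

(* Weights are total functions on {set V}; only their values on E matter, here
   and in weight_entropy. *)
Definition fractional_perfect_matching (R : realType) (V : finType)
    (E : {set {set V}}) (x : {set V} -> R) : Prop :=
  (forall e : {set V}, e \in E -> 0 <= x e <= 1) /\
  (forall v : V, \sum_(e in E | v \in e) x e = 1).

(* The summand vanishes when x e = 0, as 0 * ln 0 = 0. *)
Definition weight_entropy (R : realType) (V : finType)
    (E : {set {set V}}) (x : {set V} -> R) : R :=
  - \sum_(e in E) x e * ln (x e).

(* The supremum of the empty set is -oo. *)
Definition entropy (R : realType) (V : finType) (E : {set {set V}}) : \bar R :=
  ereal_sup [set y : \bar R | exists2 x : {set V} -> R,
    fractional_perfect_matching E x & y = (weight_entropy E x)%:E]%classic.

(* Main.v *)
Require Import Defs.
From mathcomp Require Import all_boot all_order all_algebra.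
From mathcomp Require Import all_classical all_reals all_analysis.
From mathcomp Require Import ring lra zify.

Set Implicit Arguments.
Unset Strict Implicit.
Unset Printing Implicit Defensive.

Import Order.TTheory GRing.Theory Num.Theory.
Local Open Scope ring_scope.

(** The entropy bound comes from one explicit fractional perfect matching, of
    the additive form [p e = \sum_(v in e) a v] with all [a v > 0].

    Additive weights have large entropy because -ln is convex.  Let [D > 0] be
    a lower bound for all vertex degrees.  Then
      h(p) - (n/k) ln D = - \sum_e p_e ln (D p_e)
                        = - \sum_v a_v \sum_(e containing v) ln (D p_e),
    and, since ln t <= t - 1, the inner sum over the edges at v is at most
    D * 1 - deg v <= 0 (entropy_additive_weights).  For a regular
    hypergraph this is the constant weight 1/D, with equality.

    Additive weights form a perfect matching exactly when
    [\sum_u deg {u, v} * a u = 1] for all v, where {v, v} stands for {v}.  Write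
    deg as the degree in the complete hypergraph minus the degree in the
    hypergraph F of missing k-sets.  With P = C(n-2, k-2) and Q = C(n-2, k-1)
    the matrix of the system becomes P J + Q I - M, where J is the all-ones
    matrix and M_(v, u) = deg_F {v, u}.  The row v of M sums to k deg_F {v}.  If
    this is less than Q for every v, then Q I - M is diagonally dominant with
    nonpositive off-diagonal entries, so (Q I - M) b = 1 has a solution, which
    is positive; the rank-one term P J then only rescales b
    (additive_matching_exists).

    Finally, k deg_F {v} < Q says precisely that
    deg v > ((k-1)/k) (n/(n-1)) C(n-1, k-1).  That is the hypothesis for d = 1,
    and the hypothesis for larger d implies it by double counting the pairs
    (A, e) with v in A, A inside e and #|A| = d (missing_degree_lt).  The same
    count gives deg v >= D for the number D inside the logarithm of the
    theorem. *)

(** * Diagonally dominant linear systems *)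

(** A discrete minimum principle: at an index where [x] is smallest, a negative
    value of [x] would make [q * x i - \sum_j A i j * x j] negative, since the
    row sum of [A] is less than [q]. *)
Lemma dominant_system_ge0 (R : realFieldType) (T : finType)
    (A : T -> T -> R) (q : R) (x : T -> R) :
  (forall i j, 0 <= A i j) -> (forall i, \sum_j A i j < q) ->
  (forall i, 0 <= q * x i - \sum_j A i j * x j) ->
  forall i, 0 <= x i.
Proof.
move=> A_ge0 rowA xB i.
case: (@Order.TotalTheory.arg_minP _ _ _ i xpredT x erefl) => m _ x_min.
apply: le_trans (x_min i erefl); rewrite leNgt; apply/negP => xm_lt0.
have : (\sum_j A m j) * x m <= \sum_j A m j * x j.
  by rewrite mulr_suml; apply: ler_sum => j _; rewrite ler_wpM2l // x_min.
have : q * x m < (\sum_j A m j) * x m by rewrite ltr_nM2r.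
by have := xB m; lra.
Qed.

(** The minimum principle applied to [x] and [- x] shows that the square matrix
    [q I - A] has trivial kernel, hence is invertible. *)
Lemma dominant_system_solvable (R : realFieldType) (T : finType)
    (A : T -> T -> R) (q : R) :
  (forall i j, 0 <= A i j) -> (forall i, \sum_j A i j < q) ->
  exists b : T -> R, forall i, q * b i = 1 + \sum_j A i j * b j.
Proof.
move=> A_ge0 rowA.
(* Transposed, because the matrix acts on row vectors from the right. *)
pose M : 'M[R]_#|T| :=
  \matrix_(j, i) (q *+ (j == i) - A (enum_val i) (enum_val j)).
pose fn (v : 'rV[R]_#|T|) (t : T) := v ord0 (enum_rank t).
have fnM v i : fn (v *m M) i = q * fn v i - \sum_j A i j * fn v j.
  rewrite /fn mxE.
  under eq_bigr do rewrite mxE mulrBr.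
  rewrite sumrB (bigD1 (enum_rank i)) //= eqxx mulr1n big1 ?addr0; last first.
    by move=> j /negPf ->; rewrite mulr0n mulr0.
  rewrite mulrC; congr (_ - _).
  rewrite (reindex_onto enum_rank enum_val) /=; last first.
    by move=> j; rewrite enum_valK.
  apply: eq_big => [j|j _]; first by rewrite enum_rankK eqxx.
  by rewrite !enum_rankK mulrC.
have M_unit : M \in unitmx.
  rewrite -row_free_unit; apply: inj_row_free => v vM0.
  have fn0 i : fn v i = 0.
    apply/le_anti/andP; split.
      rewrite -oppr_ge0; move: i; apply: (dominant_system_ge0 A_ge0 rowA) => i.
      under eq_bigr do rewrite mulrN.
      by rewrite sumrN mulrN -opprB opprK addrC -fnM vM0 /fn mxE.
    move: i; apply: (dominant_system_ge0 A_ge0 rowA) => i.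
    by rewrite -fnM vM0 /fn mxE.
  apply/rowP => j; rewrite mxE -(enum_valK j); exact: fn0.
exists (fn (const_mx 1 *m invmx M)) => i.
apply/eqP; rewrite -subr_eq -fnM.
by rewrite mulmxKV // /fn mxE.
Qed.

(** * Counting edges *)

Lemma card_sets_between (T : finType) (S B : {set T}) (d : nat) :
  S \subset B -> (#|S| <= d)%N ->
  #|[set A : {set T} | [&& S \subset A, A \subset B & #|A| == d]]|
    = 'C(#|B| - #|S|, d - #|S|).
Proof.
move=> sSB leSd.
rewrite -(cardsDS sSB) -cards_draws.
rewrite -[RHS](@card_in_imset _ _ (fun A => A :|: S)); last first.
  move=> A1 A2; rewrite !inE !subsetD.
  move=> /andP[/andP[_ dA1] _] /andP[/andP[_ dA2] _].
  move=> /(congr1 (fun A => A :\: S)).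
  rewrite !finset.setDUl !finset.setDv !finset.setU0.
  by rewrite (finset.setDidPl dA1) (finset.setDidPl dA2).
congr #|pred_of_set _|; apply/setP => A; rewrite inE; apply/idP/imsetP.
  case/and3P => sSA sAB /eqP cardA; exists (A :\: S).
    by rewrite !inE finset.setSD //= cardsDS // cardA.
  apply/setP => u; rewrite !inE.
  by case: (boolP (u \in S)) => [/(fintype.subsetP sSA) ->|];
    rewrite ?orbT ?orbF.
case=> A'; rewrite !inE subsetD => /andP[/andP[sA'B dA'S] /eqP cA'] ->.
rewrite finset.subsetUr finset.subUset sA'B sSB /=.
by rewrite cardsU (disjoint_setI0 dA'S) cards0 subn0 cA' subnK.
Qed.

(** Edges and missing k-sets together make up the complete k-uniform
    hypergraph, in which all sets of one size have the same degree. *)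
Lemma degree_complement (V : finType) (E : {set {set V}}) (k : nat) (S : {set V}) :
  uniform_hypergraph k E -> (#|S| <= k)%N ->
  (degree E S + degree ([set e : {set V} | #|e| == k] :\: E) S)%N
    = 'C(#|V| - #|S|, k - #|S|).
Proof.
move=> unifE leSk; rewrite -cardsT -card_sets_between ?finset.subsetT //.
rewrite /degree -cardsUI [X in (_ + X)%N](_ : _ = 0%N) ?addn0; last first.
  apply/eqP; rewrite cards_eq0 -finset.subset0; apply/fintype.subsetP => e.
  by rewrite !inE; case: (e \in E); rewrite ?andbF.
congr #|pred_of_set _|; apply/setP => e; rewrite !inE finset.subsetT /=.
have [/unifE ->|_] := boolP (e \in E); first by rewrite eqxx !andbT /= orbF.
by rewrite /= andbC.
Qed.

(** Double counting of the pairs (A, e) with [S \subset A \subset e] and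
    [#|A| = d]. *)
Lemma sum_degree_supersets (V : finType) (E : {set {set V}}) (k d : nat)
    (S : {set V}) :
  uniform_hypergraph k E -> (#|S| <= d)%N ->
  (\sum_(A : {set V} | (#|A| == d) && (S \subset A)) degree E A)%N
    = ('C(k - #|S|, d - #|S|) * degree E S)%N.
Proof.
move=> unifE leSd.
under eq_bigr do rewrite /degree -sum1dep_card.
rewrite (exchange_big_dep (fun e => (e \in E) && (S \subset e))) /=; last first.
  by move=> A e /andP[_ sSA] /andP[-> sAe]; rewrite (fintype.subset_trans sSA).
rewrite (eq_bigr (fun=> 'C(k - #|S|, d - #|S|))); last first.
  move=> e /andP[eE sSe]; rewrite -(unifE e eE) -(card_sets_between sSe leSd).
  rewrite -sum1dep_card; apply: eq_bigl => A.
  by rewrite eE /= -andbA andbC -andbA.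
by rewrite sum_nat_cond_const mulnC.
Qed.

(** Exchanging the sums turns the vertex weights of an additive edge weight into
    a matrix product.  The diagonal term is an ordinary degree, as
    [[set v; v]] is the singleton. *)
Lemma sum_edge_weights (R : comPzRingType) (V : finType) (E : {set {set V}})
    (f : V -> R) (v : V) :
  \sum_(e in E | v \in e) \sum_(u in e) f u
    = \sum_u (degree E [set v; u])%:R * f u.
Proof.
rewrite (exchange_big_dep xpredT) //=; apply: eq_bigr => u _.
rewrite sumr_const mulr_natl; congr (_ *+ _).
apply: eq_card => e.
by rewrite !inE unfold_in finset.subUset !finset.sub1set andbA.
Qed.

Lemma min_degree_le (V : finType) (E : {set {set V}}) (A : {set V}) :
  (min_degree E #|A| <= degree E A)%N.
Proof.
have := @bigmin_le_cond _ nat _ #|E| A (fun A' => #|A'| == #|A|) (degree E).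
exact.
Qed.

(** In the double count of sum_degree_supersets, each of the
    C(n - #|S|, d - #|S|) terms is at least the minimum d-degree. *)
Lemma min_degree_sub (V : finType) (E : {set {set V}}) (k d : nat) (S : {set V}) :
  uniform_hypergraph k E -> (#|S| <= d)%N ->
  ('C(#|V| - #|S|, d - #|S|) * min_degree E d
    <= 'C(k - #|S|, d - #|S|) * degree E S)%N.
Proof.
move=> unifE leSd; rewrite -(sum_degree_supersets unifE leSd).
rewrite -cardsT -(card_sets_between (finset.subsetT S) leSd) -sum_nat_const.
rewrite (eq_bigl (fun A : {set V} => (#|A| == d) && (S \subset A))); last first.
  by move=> A; rewrite inE finset.subsetT /= andbC.
by apply: leq_sum => A /andP[/eqP <- _]; exact: min_degree_le.
Qed.

Lemma bin_trinomial n k d : (d <= k)%N -> (k <= n)%N ->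
  ('C(n, k) * 'C(k, d) = 'C(n, d) * 'C(n - d, k - d))%N.
Proof.
move=> dk kn; apply/eqP.
have f0 m := fact_gt0 m.
rewrite -(eqn_pmul2r (f0 d)) -(eqn_pmul2r (f0 (k - d)%N)).
rewrite -(eqn_pmul2r (f0 (n - k)%N)).
have h1 := bin_fact kn; have h2 := bin_fact dk.
have h3 := bin_fact (leq_trans dk kn).
have h4 := @bin_fact (n - d) (k - d) (leq_sub2r d kn).
rewrite (_ : (n - d - (k - d) = n - k)%N) in h4; last by lia.
by apply/eqP; rewrite -!mulnA in h1 h2 h3 h4 *; nia.
Qed.

(** The role of the degree threshold.  Passing from d-sets to the vertex v gives
    [deg v > ((k-1)/k) (n/(n-1)) C(n-1, k-1)]; subtracting from C(n-1, k-1) and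
    multiplying by k leaves less than [((n-k)/(n-1)) C(n-1, k-1) = C(n-2, k-1)].
    Denominators are cleared to stay within the natural numbers. *)
Lemma missing_degree_lt (V : finType) (E : {set {set V}}) (k d : nat) (v : V) :
  (1 <= d <= k)%N -> (2 <= k <= #|V|)%N -> uniform_hypergraph k E ->
  ((k - 1) * #|V| * 'C(#|V| - d, k - d) < k * (#|V| - 1) * min_degree E d)%N ->
  (k * degree ([set e : {set V} | #|e| == k] :\: E) [set v]
    < 'C(#|V| - 2, k - 1))%N.
Proof.
move=> /andP[d_gt0 le_dk] /andP[k_ge2 le_kn] unifE min_deg_gt.
have := min_degree_sub (d := d) (S := [set v]) unifE.
have := degree_complement (S := [set v]) unifE.
rewrite cards1 => /(_ (ltnW k_ge2)).
set F := _ :\: E => degEF /(_ d_gt0) degE_ge.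
(* Choosing the vertices of an edge at v in two stages: first a d-set at v. *)
have trinom : ('C(#|V| - 1, k - 1) * 'C(k - 1, d - 1)
    = 'C(#|V| - 1, d - 1) * 'C(#|V| - d, k - d))%N.
  rewrite bin_trinomial ?leq_sub2r //.
  by congr (_ * 'C(_, _))%N; lia.
have absorb := mul_bin_down (#|V| - 1) (k - 1).
have C1_gt0 : (0 < 'C(k - 1, d - 1))%N by rewrite bin_gt0 leq_sub2r.
have C2_gt0 : (0 < 'C(#|V| - 1, d - 1))%N.
  by rewrite bin_gt0 leq_sub2r // (leq_trans le_dk).
have predE : ((#|V| - 1).-1 = #|V| - 2)%N by lia.
have subE : (#|V| - 1 - (k - 1) = #|V| - k)%N by lia.
rewrite predE subE in absorb.
have deg_gt : ((k - 1) * #|V| * 'C(#|V| - 1, k - 1)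
    < k * (#|V| - 1) * degree E [set v])%N.
  rewrite -(ltn_pmul2r C1_gt0) -mulnA trinom mulnCA.
  apply: (@leq_trans ('C(#|V| - 1, d - 1) * (k * (#|V| - 1) * min_degree E d))).
    by rewrite ltn_pmul2l.
  rewrite mulnCA -[leqRHS]mulnA leq_mul2l.
  by rewrite [(degree _ _ * _)%N]mulnC degE_ge orbT.
have n1_gt0 : (0 < #|V| - 1)%N by lia.
rewrite -(ltn_pmul2l n1_gt0) absorb -degEF.
move: deg_gt; rewrite -degEF.
move: (degree E _) (degree F _) => p q deg_gt.
nia.
Qed.

(** * Entropy of additive edge weights *)

Lemma ln_le_subr1 (R : realType) (t : R) : 0 < t -> ln t <= t - 1.
Proof. by move=> t_gt0; rewrite -{1}[t](subrKC 1) le_ln1Dx //; lra. Qed.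

(** Sum the matching condition over all vertices; every edge is counted k
    times. *)
Lemma sum_matching (R : realType) (V : finType) (E : {set {set V}}) (k : nat)
    (x : {set V} -> R) :
  uniform_hypergraph k E -> fractional_perfect_matching E x ->
  k%:R * \sum_(e in E) x e = #|V|%:R.
Proof.
move=> unifE [_ x_sum].
transitivity (\sum_(v : V) \sum_(e in E | v \in e) x e); last first.
  by rewrite (eq_bigr (fun=> 1)) // sumr_const.
rewrite (exchange_big_dep (mem E)) /=; last by move=> v e _ /andP[].
rewrite mulr_sumr; apply: eq_bigr => e eE.
rewrite (eq_bigl (mem e)); last by move=> v; rewrite eE.
by rewrite sumr_const (unifE e eE) mulr_natl.
Qed.

(** Distributing [p e * ln (D * p e)] over the vertices of [e] leaves, for every
    vertex, a sum of logarithms over the edges at that vertex.  The tangent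
    bound ln t <= t - 1 makes this sum at most [D - deg v], because the weights
    at a vertex add up to 1. *)
Lemma entropy_additive_weights (R : realType) (V : finType) (E : {set {set V}})
    (k : nat) (a : V -> R) (D : R) :
  (0 < k)%N -> uniform_hypergraph k E ->
  0 < D -> (forall v, D <= (degree E [set v])%:R) ->
  (forall v, 0 < a v) ->
  let p := fun e : {set V} => \sum_(v in e) a v in
  fractional_perfect_matching E p ->
  #|V|%:R / k%:R * ln D <= weight_entropy E p.
Proof.
move=> k_gt0 unifE D_gt0 D_le a_gt0 p pmp; have [_ p_sum] := pmp.
have -> : #|V|%:R / k%:R = \sum_(e in E) p e.
  by rewrite -(sum_matching unifE pmp) mulrC mulKf // pnatr_eq0 -lt0n.
have p_gt0 e : e \in E -> 0 < p e.
  move=> eE; have [v ve] : exists v, v \in e.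
    by apply/card_gt0P; rewrite (unifE e eE).
  by rewrite /p (bigD1 v) //= ltr_pwDl // sumr_ge0 // => u _; exact: ltW.
suff : \sum_(e in E) p e * ln (D * p e) <= 0.
  have -> : \sum_(e in E) p e * ln (D * p e)
      = (\sum_(e in E) p e) * ln D - weight_entropy E p.
    rewrite /weight_entropy opprK mulr_suml -big_split /=.
    by apply: eq_bigr => e eE; rewrite lnM ?posrE ?p_gt0 // mulrDr.
  by rewrite subr_le0.
rewrite (eq_bigr (fun e : {set V} =>
  \sum_(v in e) a v * ln (D * p e))); last first.
  by move=> e _; rewrite mulr_suml.
rewrite (exchange_big_dep xpredT) //= -oppr_ge0 -sumrN sumr_ge0 // => v _.
rewrite -mulr_sumr oppr_ge0 pmulr_rle0 //.
apply: (@le_trans _ _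
  (\sum_(e : {set V} | (e \in E) && (v \in e)) (D * p e - 1))).
  by apply: ler_sum => e /andP[eE _]; rewrite ln_le_subr1 // mulr_gt0 // p_gt0.
rewrite sumrB -mulr_sumr p_sum mulr1 sumr_const subr_le0.
rewrite (le_trans (D_le v)) // ler_nat eq_leq //.
by apply: eq_card => e; rewrite !inE unfold_in finset.sub1set.
Qed.

(** * Existence of an additive perfect matching *)

(** The hypothesis bounds the row sums of the missing codegree matrix by
    Q = C(n-2, k-1), the difference between the diagonal and the off-diagonal
    entries of the codegree matrix of the complete hypergraph. *)
Lemma additive_matching_exists (R : realType) (V : finType) (E : {set {set V}})
    (k : nat) :
  (2 <= k)%N -> uniform_hypergraph k E ->
  (forall v, (k * degree ([set e : {set V} | #|e| == k] :\: E) [set v]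
    < 'C(#|V| - 2, k - 1))%N) ->
  exists2 a : V -> R, (forall v, 0 < a v)
    & fractional_perfect_matching E (fun e => \sum_(v in e) a v).
Proof.
move=> k_ge2 unifE; set F := _ :\: E => degF_lt.
have unifF : uniform_hypergraph k F.
  by move=> e; rewrite !inE => /andP[_ /eqP].
set Q := 'C(#|V| - 2, k - 1) in degF_lt *.
pose P := 'C(#|V| - 2, k - 2).
pose M (v u : V) : R := (degree F [set v; u])%:R.
have rowM v : \sum_u M v u < Q%:R.
  have := sum_edge_weights F (fun=> 1 : R) v.
  under [in RHS]eq_bigr do rewrite mulr1.
  move=> <-; rewrite (eq_bigr (fun=> k%:R)); last first.
    by move=> e /andP[/unifF <- _]; rewrite sumr_const.
  rewrite sumr_const -mulrnA ltr_nat; apply: leq_ltn_trans _ (degF_lt v).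
  rewrite leq_pmul2l ?(ltnW k_ge2) // eq_leq //.
  rewrite /degree; apply: eq_card => e.
  by rewrite !inE unfold_in finset.sub1set !inE.
have M_ge0 v u : 0 <= M v u by exact: ler0n.
have [b bE] := dominant_system_solvable M_ge0 rowM.
have b_ge0 v : 0 <= b v.
  move: v; apply: (dominant_system_ge0 M_ge0 rowM).
  by move=> v; rewrite bE addrK.
have b_gt0 v : 0 < b v.
  have : 0 < Q%:R * b v.
    by rewrite bE ltr_pwDl // sumr_ge0 // => u _; rewrite mulr_ge0.
  by apply: contraTT; rewrite -!leNgt => b_le0; rewrite mulr_ge0_le0.
(* Pascal's rule: on the diagonal, C(n-1, k-1) = P + Q. *)
have degE v u : (degree E [set v; u])%:R = P%:R + (Q%:R *+ (v == u)) - M v u.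
  have := degree_complement unifE (S := [set v; u]).
  rewrite cards2 -/F => degEF.
  apply/eqP; rewrite eq_sym subr_eq -natrD degEF; last first.
    by case: (v == u) => //; lia.
  case: (v == u) => /=; last by rewrite addr0.
  have lt_kV : (2 <= #|V|)%N.
    have : (0 < Q)%N by apply: leq_trans (degF_lt v); rewrite ltnS.
    by rewrite bin_gt0; lia.
  rewrite mulr1n -natrD /P /Q [X in X%:R == _]addnC.
  have -> : (k - 1 = (k - 2).+1)%N by lia.
  by have -> : (#|V| - 1 = (#|V| - 2).+1)%N by lia.
(* (P J + Q I - M) b = (1 + P \sum b) 1, so dividing b by t solves the full
   system. *)
pose t := 1 + P%:R * \sum_u b u.
have t_gt0 : 0 < t by rewrite ltr_pwDl // mulr_ge0 // sumr_ge0.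
pose a v := b v / t.
have a_gt0 v : 0 < a v by rewrite divr_gt0.
have a_sum v : \sum_(e in E | v \in e) \sum_(u in e) a u = 1.
  rewrite sum_edge_weights.
  rewrite (eq_bigr (fun u =>
    (P%:R * b u + (Q%:R * b u) *+ (v == u) - M v u * b u) / t)).
    rewrite -mulr_suml sumrB big_split /= -mulr_sumr.
    have -> : \sum_u (Q%:R * b u) *+ (v == u) = Q%:R * b v.
      rewrite (bigD1 v) //= eqxx mulr1n big1 ?addr0 // => u /negPf.
      by rewrite eq_sym => ->.
    by rewrite bE addrA addrK addrC divff ?gt_eqF.
  move=> u _; rewrite degE /a mulrA; congr (_ / t).
  by case: (v == u); rewrite ?mulr1n ?mulr0n; ring.
exists a => //; split=> // e eE.
have p_ge0 e' : 0 <= \sum_(u in e') a u by apply: sumr_ge0 => u _; exact: ltW.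
rewrite p_ge0 /=.
have [v ve] : exists v, v \in e.
  by apply/card_gt0P; rewrite (unifE e eE); apply: leq_trans k_ge2.
rewrite -(a_sum v) (bigD1 e) /=; last by rewrite eE.
by rewrite lerDl sumr_ge0.
Qed.

(** * The entropy bound *)

Theorem theorem1p10 (R : realType) (k d n : nat)
    (k_ge2 : (2 <= k)%N) (d_ge1 : (1 <= d)%N) (d_lt : (d < k - 1)%N)
    (V : finType) (E : {set {set V}})
    (cardV : #|V| = n) (n_ge_k : (k <= n)%N)
    (unifE : uniform_hypergraph k E)
    (min_deg_gt :
       (k%:R - 1) / k%:R * (n%:R / (n%:R - 1)) * 'C(n - d, k - d)%:R
         < (min_degree E d)%:R :> R) :
  ((n%:R / k%:R *
     ln (k%:R / n%:R * ('C(n, d)%:R / 'C(k, d)%:R) * (min_degree E d)%:R))%:E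
    <= entropy R E)%E.
Proof.
have le_dk : (d <= k)%N by lia.
have n_gt0 : 0 < n%:R :> R by rewrite ltr0n; lia.
have k_gt0 : 0 < k%:R :> R by rewrite ltr0n; lia.
have n1_gt0 : 0 < n%:R - 1 :> R by rewrite subr_gt0 ltr1n; lia.
have Cnd_gt0 : (0 < 'C(n, d))%N by rewrite bin_gt0; lia.
have Ckd_gt0 : (0 < 'C(k, d))%N by rewrite bin_gt0.
have min_deg_gt0 : 0 < (min_degree E d)%:R :> R.
  apply: le_lt_trans min_deg_gt.
  by rewrite !mulr_ge0 ?invr_ge0 ?subr_ge0 ?ler1n ?(ltW n1_gt0) //; lia.
have min_deg_gt_nat :
    ((k - 1) * #|V| * 'C(#|V| - d, k - d) < k * (#|V| - 1) * min_degree E d)%N.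
  rewrite cardV -(ltr_nat R) !natrM !natrB; try lia.
  rewrite -subr_gt0; set X := (X in 0 < X).
  suff -> : X = k%:R * (n%:R - 1) * ((min_degree E d)%:R - (k%:R - 1) / k%:R
      * (n%:R / (n%:R - 1)) * 'C(n - d, k - d)%:R).
    by rewrite !mulr_gt0 // subr_gt0.
  by rewrite /X; field; rewrite !gt_eqF.
have dk : (1 <= d <= k)%N by rewrite d_ge1.
have kn : (2 <= k <= #|V|)%N by rewrite cardV k_ge2.
have [a a_gt0 pm_a] : exists2 a : V -> R, (forall v, 0 < a v)
    & fractional_perfect_matching E (fun e => \sum_(v in e) a v).
  apply: (additive_matching_exists _ k_ge2 unifE) => v.
  exact: missing_degree_lt dk kn unifE min_deg_gt_nat.
apply: (@le_trans _ _ (weight_entropy E (fun e => \sum_(v in e) a v))%:E).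
  rewrite lee_fin -{1}cardV; apply: entropy_additive_weights => //; first lia.
    by rewrite !mulr_gt0 ?invr_gt0 ?(ltr0n R 'C(_, _)).
  move=> v; have := min_degree_sub (d := d) (S := [set v]) unifE.
  rewrite cards1 => /(_ d_ge1).
  have := mul_bin_diag n (d - 1); have := mul_bin_diag k (d - 1).
  rewrite cardV -!subn1 (_ : (d - 1).+1 = d)%N; last by lia.
  move=> /(congr1 (fun m => m%:R : R)) eqk /(congr1 (fun m => m%:R : R)) eqn.
  rewrite !natrM in eqk eqn; rewrite -(ler_nat R) !natrM => degE_ge.
  have C1_gt0 : 0 < 'C(k - 1, d - 1)%:R :> R by rewrite ltr0n bin_gt0 leq_sub2r.
  (* By the absorption identities eqk and eqn, the argument of ln equals
     C(n-1, d-1) / C(k-1, d-1) times the minimum d-degree. *)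
  rewrite -(ler_pM2l C1_gt0); apply: le_trans degE_ge.
  have -> : 'C(k - 1, d - 1)%:R = d%:R * 'C(k, d)%:R / k%:R :> R.
    by rewrite -eqk mulrC mulKf // gt_eqF.
  have -> : 'C(n - 1, d - 1)%:R = d%:R * 'C(n, d)%:R / n%:R :> R.
    by rewrite -eqn mulrC mulKf // gt_eqF.
  rewrite le_eqVlt; apply/orP; left; apply/eqP; field.
  by rewrite (gt_eqF n_gt0) (gt_eqF k_gt0) gt_eqF ?ltr0n.
rewrite /entropy; apply: ereal_sup_ubound.
by exists (fun e : {set V} => \sum_(v in e) a v).
Qed.
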